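(* Let $0<p\le 1/2$, let $m\ge 1$ be an integer and let $R\in[0,1]$. Let $\mathcal C$ be a family (sequence) of stabilizer codes of rates at least $R$ whose decoding error probability $P_{err}$ over the quantum erasure channel of erasure probability $p$ tends to $0$ along the family. Suppose furthermore that every code in $\mathcal C$ has a set of generators of its stabilizer group whose weights are all at most $m$. Then $$R\le (1-2p)\,\frac{1-(1-p)^{m-1}}{1-(1-2p)(1-p)^{m-1}}.$$
   Context: Pauli group: $\mathcal P_n$ is the group of $n$-fold tensor products of $I,X,Y,Z$ taken modulo phases $\{\pm1,\pm i\}$; it is identified with $\mathbb F_2^{2n}$ by $X_i\mapsto(e_i|0)$, $Z_i\mapsto(0|e_i)$, $Y_i\mapsto (e_i|e_i)$, so that multiplication becomes addition. Two elements commute or anti-commute (as operators); $E,E'$ anti-commute iff the number of positions $j$ where $E_j,E'_j$ are distinct and both different from $I$ is odd. The weight of $E\in\mathcal P_n$ is its number of non-identity components. A stabilizer code of length $n$ is given by a stabilizer group $S\subset\mathcal P_n$ generated by pairwise commuting elements $S_1,\dots,S_r$. The code encodes $k=n-\operatorname{rank}S$ qubits ($\operatorname{rank} S$ being the $\mathbb F_2$-dimension of $S$), and has rate $k/n$. The syndrome of $E\in\mathcal P_n$ is $\sigma(E)\in\mathbb F_2^r$, whose $i$-th coordinate is $0$ if $E$ commutes with $S_i$ and $1$ otherwise. Quantum erasure channel of probability $p$: the erasure $\mathcal E\in\mathbb F_2^n$ is random with i.i.d. Bernoulli($p$) coordinates; given $\mathcal E$, the error $E$ is uniform among Pauli operators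 $E\in\mathcal P_n$ with $E_i=I$ whenever $\mathcal E_i=0$. The decoder sees $(\mathcal E,\sigma(E))$ and must determine the coset $E\cdot S\in \mathcal P_n/S$. $P_{err}$ is the probability that the best possible estimate $\hat X$ of $X=E\cdot S$, as a function of $(\mathcal E,\sigma(E))$, differs from $X$. *)

(* Defs.v *)
From HB Require Import structures.
From mathcomp Require Import all_boot all_order all_algebra.
From mathcomp Require Import all_classical all_reals all_analysis.

Set Implicit Arguments.
Unset Strict Implicit.
Unset Printing Implicit Defensive.

Import Order.TTheory GRing.Theory Num.Theory.
Import numFieldNormedType.Exports.

Local Open Scope ring_scope.

(* The n-qubit Pauli group modulo phases, written additively: (x | z) is the   *)
(* operator whose j-th component is I, X, Z or Y according as (x_j, z_j) is    *)
(* (0, 0), (1, 0), (0, 1) or (1, 1).                                           *)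
Notation pauli n := ('rV['F_2]_n * 'rV['F_2]_n)%type.

Section Pauli.
Variable n : nat.
Implicit Types E : pauli n.

Definition component E (j : 'I_n) : 'F_2 * 'F_2 := (E.1 0 j, E.2 0 j).

Definition weight E : nat := #|[set j | component E j != 0]|.

Definition anticommute E E' : bool :=
  odd #|[set j | [&& component E j != component E' j,
                     component E j != 0 & component E' j != 0]]|.

Definition pcoset (S : {vspace pauli n}) E : {set pauli n} :=
  [set E + s | s : pauli n in S].

Definition pquotient (S : {vspace pauli n}) : {set {set pauli n}} :=
  [set pcoset S E | E : pauli n].

End Pauli.

Record stabcode := StabCode {
  len : nat;
  len_gt0 : (0 < len)%N;
  ngens : nat;
  gens : ngens.-tuple (pauli len);
  gens_commute :
    forall i j : 'I_ngens, ~~ anticommute (tnth gens i) (tnth gens j)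
}.

(* Over 'F_2 the subgroup generated by a family is its linear span.            *)
Definition stabgroup (C : stabcode) : {vspace pauli (len C)} := <<gens C>>%VS.

(* The subtraction is made in F, so it is not truncated.                       *)
Definition rate (F : realType) (C : stabcode) : F :=
  ((len C)%:R - (\dim (stabgroup C))%:R) / (len C)%:R.

Definition syndrome (C : stabcode) (E : pauli (len C)) : 'rV['F_2]_(ngens C) :=
  \row_i (anticommute E (tnth (gens C) i))%:R.

Definition has_generators_of_weight (m : nat) (C : stabcode) : Prop :=
  exists2 t : seq (pauli (len C)),
    <<t>>%VS = stabgroup C & forall E, E \in t -> (weight E <= m)%N.

(* What the decoder sees is the pair (erasure, syndrome).                      *)
Notation decoder C :=
  {ffun 'rV['F_2]_(len C) * 'rV['F_2]_(ngens C) -> {set pauli (len C)}}.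

Section ErasureChannel.
Variables (F : realType) (p : F).

Definition erasure_prob n (e : 'rV['F_2]_n) : F :=
  \prod_(i < n) (if e 0 i == 1 then p else 1 - p).

Definition supported n (e : 'rV['F_2]_n) : {set pauli n} :=
  [set E | [forall i, (e 0 i == 0) ==> (component E i == 0)]].

Definition error_prob n (e : 'rV['F_2]_n) (E : pauli n) : F :=
  if E \in supported e then #|supported e|%:R^-1 else 0.

Definition decoder_error (C : stabcode) (d : decoder C) : F :=
  \sum_(e : 'rV['F_2]_(len C)) \sum_(E : pauli (len C))
    erasure_prob e * error_prob e E *
    (d (e, syndrome E) != pcoset (stabgroup C) E)%:R.

(* The minimum over all decoders with values in the quotient by the stabilizer *)
(* group.  The default value 1 is immaterial: for 0 <= p <= 1 every term is a  *)
(* probability, and there is at least one decoder.                             *)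
Definition Perr (C : stabcode) : F :=
  \big[Order.min/1]_(d : decoder C | [forall o, d o \in pquotient (stabgroup C)])
    decoder_error d.

End ErasureChannel.

(* Main.v *)
(* Fix a code with stabilizer S of rank r, and for a set A of positions let    *)
(* h(A) be the dimension of the subgroup of S supported in A.  For an erased   *)
(* set A the syndrome takes at most 2^(r - h(~A)) values, and each observation *)
(* singles out at most 2^h(A) of the 4^|A| equiprobable errors.  So the        *)
(* decoder succeeds with probability at most 2^-(2|A| - r + h(~A) - h(A)), and *)
(* averaging over A, with g(q) = E h(A) for A random of density q, gives       *)
(*   2pn - r + g(1-p) - g(p) <= 4n Perr.                                       *)
(* Since h is supermodular and h(0) = 0, thinning a random set of density 1-p  *)
(* by p/(1-p) shows g(p) <= p/(1-p) g(1-p), so g(1-p) - g(p) is at least       *)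
(* (1-2p)/(1-p) g(1-p).  Finally g(1-p) >= r (1-p)^m, because each of r        *)
(* independent generators of weight at most m lies in the random set with      *)
(* probability at least (1-p)^m.  The bound follows by solving for r/n.        *)

(* With r and g as above, [card_decoded] says that good decoding costs rank: r must reach about 2pn
   + g(1-p) - g(p), which [Perr_ge] records up to an error 4n Perr. Generators of low weight make
   g(1-p) large ([expect_subdim_ge]), and supermodularity keeps g(p) small in comparison
   ([supermodular_expect]). Hence r/n times 1-(1-2p)(1-p)^(m-1) is at least 2p - 4 Perr; since r/n
   is 1 minus the rate, Perr tending to 0 bounds the rate ([Perr_lower_bound]). *)
Require Import Defs.
From HB Require Import structures.
From mathcomp Require Import all_boot all_order all_algebra.
From mathcomp Require Import all_classical all_reals all_analysis.
From mathcomp Require Import ring lra finfield.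

Set Implicit Arguments.
Unset Strict Implicit.
Unset Printing Implicit Defensive.

Import Order.TTheory GRing.Theory Num.Theory.
Import numFieldNormedType.Exports.

Local Open Scope ring_scope.

(** * Random subsets *)

Section RandomSubset.
Import boot.fintype boot.finset.
Variables (F : realType) (I : finType).
Implicit Types (q s : F) (A B U V : {set I}) (f g : {set I} -> F).

Definition subset_prob q A : F := \prod_i (if i \in A then q else 1 - q).

Definition expect q f : F := \sum_(A : {set I}) subset_prob q A * f A.

Lemma subset_prob_ge0 q A : 0 <= q <= 1 -> 0 <= subset_prob q A.
Proof. by move=> /andP[q0 q1]; apply: prodr_ge0 => i _; case: ifP => _ //; lra. Qed.

Lemma subset_probC q A : subset_prob q (~: A) = subset_prob (1 - q) A.
Proof.
by apply: eq_bigr => i _; rewrite inE; case: (i \in A) => //=; ring.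
Qed.

Lemma expectC q f : expect (1 - q) f = expect q (fun A => f (~: A)).
Proof.
rewrite /expect (reindex_inj (@setC_inj I)) /=.
by apply: eq_bigr => A _; rewrite subset_probC; congr (subset_prob _ _ * _); ring.
Qed.

Lemma eq_expect q f g : f =1 g -> expect q f = expect q g.
Proof. by move=> fg; apply: eq_bigr => A _; rewrite fg. Qed.

Lemma expectD q f g : expect q (fun A => f A + g A) = expect q f + expect q g.
Proof. by rewrite -big_split; apply: eq_bigr => A _; rewrite mulrDr. Qed.

Lemma expectZ q (c : F) f : expect q (fun A => c * f A) = c * expect q f.
Proof. by rewrite big_distrr; apply: eq_bigr => A _ /=; rewrite mulrCA. Qed.

Lemma expect_sum q (J : Type) (r : seq J) (f : J -> {set I} -> F) :
  expect q (fun A => \sum_(j <- r) f j A) = \sum_(j <- r) expect q (f j).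
Proof. by rewrite exchange_big; apply: eq_bigr => A _; rewrite mulr_sumr. Qed.

Lemma ler_expect q f g : 0 <= q <= 1 -> (forall A, f A <= g A) ->
  expect q f <= expect q g.
Proof.
by move=> q01 fg; apply: ler_sum => A _; rewrite ler_wpM2l ?subset_prob_ge0.
Qed.

(** The indicator is absorbed position by position into the product weight; [bigA_distr] then turns
    the sum over subsets into a product of two-term sums, equal to q on B and to 1 elsewhere. *)
Lemma expect_superset q B : expect q (fun A => (B \subset A)%:R) = q ^+ #|B|.
Proof.
transitivity (\sum_(A : {set I})
  \prod_i (if i \in A then q else (i \notin B)%:R * (1 - q))).
  apply: eq_bigr => A _; have [/subsetP BA | /subsetPn[i iB iA]] := boolP (B \subset A).
    rewrite mulr1; apply: eq_bigr => i _; case: ifPn => // iA.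
    by rewrite (contra (BA i) iA) mul1r.
  by rewrite mulr0 [RHS](bigD1 i) //= (negPf iA) iB mul0r mul0r.
rewrite -(bigA_distr _ _ (fun=> q)) -prodr_const [RHS]big_mkcond /=.
by apply: eq_bigr => i _; case: (i \in B) => /=; ring.
Qed.

Lemma expect_cst q (c : F) : expect q (fun=> c) = c.
Proof.
transitivity (c * expect q (fun A => (set0 \subset A)%:R)).
  by rewrite -expectZ; apply: eq_bigr => A _; rewrite sub0set mulr1.
by rewrite expect_superset cards0 mulr1.
Qed.

Lemma expect_card q : expect q (fun A => #|A|%:R) = q * #|I|%:R.
Proof.
transitivity (expect q (fun A => \sum_(i : I) ([set i] \subset A)%:R)).
  apply: eq_bigr => A _; rewrite -sum1_card natr_sum big_mkcond /=.
  by congr (_ * _); apply: eq_bigr => i _; rewrite sub1set; case: ifP.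
rewrite expect_sum (eq_bigr (fun=> q)) => [|i _]; last by rewrite expect_superset cards1.
by rewrite sumr_const mulr_natr.
Qed.

(** A position survives two independent selections with probability sq. For a fixed value A of the
    intersection, the total weight of the pairs (U, V) factors over positions. *)
Lemma expect_thin s q f :
  expect s (fun U => expect q (fun V => f (U :&: V))) = expect (s * q) f.
Proof.
have probI U A : \sum_(V | U :&: V == A) subset_prob q V =
    \prod_i (if i \in U then (if i \in A then q else 1 - q) else (i \notin A)%:R).
  rewrite big_mkcond /=.
  transitivity (\sum_(V : {set I}) \prod_i
     (if i \in V then ((i \in U) == (i \in A))%:R * q
      else (i \notin A)%:R * (1 - q))).
    apply: eq_bigr => V _; case: eqP => [<- | /eqP UVA].
      apply: eq_bigr => i _; rewrite inE.
      by case: (i \in V); rewrite ?andbT ?andbF ?eqxx mul1r.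
    have [i iP] : exists i, ((i \in U) && (i \in V)) != (i \in A).
      apply/existsP; apply: contraR UVA; rewrite negb_exists => /forallP eqA.
      by apply/eqP/setP => i; rewrite inE; apply/eqP; have := eqA i; rewrite negbK.
    rewrite (bigD1 i) //=; move: iP.
    by do 3!case: (i \in _); rewrite ?mul0r //= !mul0r.
  rewrite -bigA_distr; apply: eq_bigr => i _.
  by case: (i \in U); case: (i \in A) => /=; ring.
transitivity (\sum_(A : {set I}) (\sum_(U : {set I}) subset_prob s U *
    \sum_(V | U :&: V == A) subset_prob q V) * f A).
  rewrite /expect; under eq_bigr => U _.
    rewrite (partition_big (fun V => U :&: V) xpredT) //= mulr_sumr; over.
  rewrite exchange_big /=; apply: eq_bigr => A _; rewrite mulr_suml.
  apply: eq_bigr => U _; rewrite -mulrA mulr_suml; congr (_ * _).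
  by apply: eq_bigr => V /eqP ->.
apply: eq_bigr => A _; congr (_ * _).
transitivity (\sum_(U : {set I}) \prod_i
    (if i \in U then s * (if i \in A then q else 1 - q)
     else (1 - s) * (i \notin A)%:R)).
  apply: eq_bigr => U _; rewrite probI -big_split /=.
  by apply: eq_bigr => i _; case: ifP.
by rewrite -bigA_distr; apply: eq_bigr => i _; case: (i \in A) => /=; ring.
Qed.

(** * Supermodular functions under thinning *)

Section Supermodular.
Variable h : {set I} -> F.
Hypothesis h0 : h set0 = 0.
Hypothesis supermod : forall A B, h A + h B <= h (A :&: B) + h (A :|: B).

(** Induction on V, removing a point i to leave W. If U misses i, then U meets V and W in the same
    set. If U contains i, supermodularity for [U :&: V] and W bounds the gain by h(V) - h(W). Since
    i lies in U with probability s, the expected gain is at most s(h(V) - h(W)). *)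
Lemma supermodular_thin s V : 0 <= s <= 1 ->
  expect s (fun U => h (U :&: V)) <= s * h V.
Proof.
move=> s01; move: {2}#|V| (leqnn #|V|) => k; elim: k V => [|k IHk] V.
  rewrite leqn0 cards_eq0 => /eqP ->.
  by under eq_expect do rewrite setI0 h0; rewrite h0 expect_cst mulr0.
have [-> _|[i iV] leVk] := set_0Vmem V.
  by under eq_expect do rewrite setI0 h0; rewrite h0 expect_cst mulr0.
pose W := V :\ i; have defV : V = i |: W by rewrite setD1K.
have /IHk IHW : (#|W| <= k)%N by move: leVk; rewrite (cardsD1 i) iV.
have step U : h (U :&: V) <= h (U :&: W) + (h V - h W) * ([set i] \subset U)%:R.
  rewrite sub1set; case: (boolP (i \in U)) => [iU | iU]; last first.
    rewrite mulr0 addr0 (_ : U :&: V = U :&: W) //; apply/setP => j.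
    by rewrite !inE; case: eqP => // ->; rewrite (negPf iU).
  have := supermod (U :&: V) W.
  have -> : U :&: V :&: W = U :&: W.
    by rewrite -setIA (setIidPr (subsetDl _ _)).
  have -> : U :&: V :|: W = V.
    apply/setP => j; rewrite !inE; case: eqP => [->|_]; first by rewrite iU iV.
    by case: (j \in U); case: (j \in V).
  by rewrite mulr1; lra.
apply: le_trans (ler_expect s01 step) _.
rewrite expectD expectZ expect_superset cards1 expr1; lra.
Qed.

Lemma supermodular_expect s q : 0 <= s <= 1 -> 0 <= q <= 1 ->
  expect (s * q) h <= s * expect q h.
Proof.
move=> s01 q01; rewrite mulrC -expect_thin -expectZ; apply: ler_expect => // V.
by under eq_expect do rewrite setIC; apply: supermodular_thin.
Qed.

End Supermodular.
End RandomSubset.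

(** * Supports and the supermodular function *)

Section Support.
Import boot.fintype boot.finset.
Variable n : nat.
Implicit Types (E x : pauli n) (A B : {set 'I_n}) (S : {vspace pauli n}).

Definition psupport E : {set 'I_n} := [set j | component E j != 0].

Definition outside A E : pauli n :=
  (\row_j ((j \notin A)%:R * E.1 0 j), \row_j ((j \notin A)%:R * E.2 0 j)).

Fact outside_is_linear A : linear (outside A).
Proof.
by move=> a [x z] [x' z']; congr pair; apply/rowP => j; rewrite !mxE; ring.
Qed.

HB.instance Definition _ A :=
  GRing.isLinear.Build 'F_2 (pauli n) (pauli n) _ (outside A) (outside_is_linear A).

(* Opaque because unification diverges when it may unfold the kernel.          *)
Fact supp_space_subproof A :
  {V : {vspace pauli n} | forall E, (E \in V) = (psupport E \subset A)}.
Proof.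
exists (lker (linfun (outside A))) => E.
rewrite memv_ker lfunE /=; apply/eqP/subsetP => [[/rowP E1 /rowP E2] j | sEA].
  rewrite inE; apply: contraR => jA; apply/eqP; congr pair.
    by have := E1 j; rewrite !mxE jA mul1r.
  by have := E2 j; rewrite !mxE jA mul1r.
congr pair; apply/rowP => j; rewrite !mxE; have [jA|jA] := boolP (j \in A).
- by rewrite mul0r.
- by have := contra (sEA j) jA; rewrite inE negbK => /eqP[-> _]; rewrite mulr0.
- by rewrite mul0r.
- by have := contra (sEA j) jA; rewrite inE negbK => /eqP[_ ->]; rewrite mulr0.
Qed.

Definition supp_space A : {vspace pauli n} := sval (supp_space_subproof A).

Lemma mem_supp_space A E : (E \in supp_space A) = (psupport E \subset A).
Proof. exact: (svalP (supp_space_subproof A)). Qed.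

Lemma supp_spaceI A B : supp_space (A :&: B) = (supp_space A :&: supp_space B)%VS.
Proof. by apply/vspaceP => E; rewrite memv_cap !mem_supp_space subsetI. Qed.

Lemma supp_spaceS A B : A \subset B -> (supp_space A <= supp_space B)%VS.
Proof.
by move=> sAB; apply/subvP => E; rewrite !mem_supp_space => /subset_trans; apply.
Qed.

Definition subdim S A : nat := \dim (S :&: supp_space A).

Lemma subdim_le S A : (subdim S A <= \dim S)%N.
Proof. exact/dimvS/capvSl. Qed.

Lemma subdim0 S : subdim S set0 = 0%N.
Proof.
apply/eqP; rewrite dimv_eq0 -subv0; apply/subvP => E.
rewrite memv_cap mem_supp_space subset0 memv0 => /andP[_ /eqP/setP suppE].
have E0 j : component E j = 0 by have := suppE j; rewrite !inE => /negbFE/eqP.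
rewrite [E]surjective_pairing; apply/eqP; congr pair; apply/rowP => j.
  by rewrite mxE; case: (E0 j).
by rewrite mxE; case: (E0 j).
Qed.

Lemma subdim_supermodular S A B :
  (subdim S A + subdim S B <= subdim S (A :&: B) + subdim S (A :|: B))%N.
Proof.
rewrite /subdim -dimv_sum_cap addnC leq_add //; apply: dimvS.
  by rewrite supp_spaceI subv_cap (subv_trans (capvSl _ _)) ?capvSl //= capvS ?capvSr.
by rewrite subv_add !capvS // supp_spaceS ?subsetUl ?subsetUr.
Qed.

(** The given generators of low weight may be dependent; a free subfamily has exactly dim S members
    and keeps the weight bound. *)
Lemma free_subfamily (K : fieldType) (vT : vectType K) (t : seq vT) :
  exists b : seq vT, [/\ free b, <<b>>%VS = <<t>>%VS & {subset b <= t}].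
Proof.
elim: t => [|x t [b [freeb spanb sbt]]]; first by exists [::]; split; rewrite ?nil_free.
have [xt | xt] := boolP (x \in <<t>>%VS).
  exists b; split=> // [|y /sbt yt]; last by rewrite inE yt orbT.
  by rewrite spanb span_cons; apply/esym/addv_idPr; rewrite -memvE.
exists (x :: b); split; first by rewrite free_cons spanb xt.
  by rewrite !span_cons spanb.
by move=> y; rewrite !inE => /orP[-> // | /sbt ->]; rewrite orbT.
Qed.

Lemma count_le_subdim S A (b : seq (pauli n)) : free b -> <<b>>%VS = S ->
  (count (fun x => psupport x \subset A) b <= subdim S A)%N.
Proof.
move=> freeb <-; rewrite -size_filter.
have /eqP <- : free [seq x <- b | psupport x \subset A] by rewrite filter_free.
apply: dimvS; rewrite subv_cap; apply/andP; split.
  by apply: sub_span => x; rewrite mem_filter => /andP[].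
by apply/span_subvP => x; rewrite mem_filter mem_supp_space => /andP[].
Qed.

(** Independent generators lying inside A are counted by linearity of expectation; each lies there
    with probability q^weight, at least q^m because q is at most 1. *)
Lemma expect_subdim_ge (F : realType) (q : F) (m : nat) S (t : seq (pauli n)) :
    0 <= q <= 1 -> <<t>>%VS = S -> (forall x, x \in t -> (weight x <= m)%N) ->
  q ^+ m * (\dim S)%:R <= expect q (fun A => (subdim S A)%:R).
Proof.
move=> q01 spant wt; have [b [freeb spanb sbt]] := free_subfamily t.
have le_sub A : \sum_(x <- b) (psupport x \subset A)%:R <= (subdim S A)%:R :> F.
  rewrite -natr_sum ler_nat; apply: leq_trans (count_le_subdim A freeb _).
    by rewrite -sum1_count [leqRHS]big_mkcond.
  by rewrite spanb.
apply: le_trans (ler_expect q01 le_sub); rewrite expect_sum.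
rewrite -spant -spanb (eqP freeb) mulr_natr -iter_addr_0 -count_predT -big_const_seq.
rewrite big_seq [leRHS]big_seq; apply: ler_sum => x /sbt /wt wx.
by rewrite expect_superset; have /andP[q0 q1] := q01; rewrite ler_wiXn2l.
Qed.

Lemma card_supp_space A : #|supp_space A| = (4 ^ #|A|)%N.
Proof.
(* [K] is the set of vectors vanishing off A; the X part and the Z part of an operator each range
   over it freely. *)
pose K := [set \row_j f j | f : {ffun 'I_n -> 'F_2} in pffun_on (0 : 'F_2) (mem A) predT].
have cardK : #|K| = (2 ^ #|A|)%N.
  rewrite card_imset ?card_pffun_on ?card_Fp // => f g /rowP fg.
  by apply/ffunP => j; have := fg j; rewrite !mxE.
have memK (x : 'rV_n) : (x \in K) = [forall j, (j \notin A) ==> (x 0 j == 0)].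
  apply/imsetP/forallP => [[f /pffun_onP[sfA _] ->] j | x0].
    by apply/implyP; rewrite mxE; apply: contraR => fj; apply: (subsetP sfA).
  exists [ffun j => x 0 j]; last by apply/rowP => j; rewrite mxE ffunE.
  apply/pffun_onP; split=> //; apply/subsetP => j; rewrite inE ffunE.
  by apply: contraR => /(implyP (x0 j)).
transitivity #|setX K K|; last by rewrite cardsX cardK -expnMn.
apply: eq_card => E; rewrite mem_supp_space !inE !memK.
apply/subsetP/andP => [sEA | [/forallP E1 /forallP E2] j].
  by split; apply/forallP => j; apply/implyP => jA; have := contra (sEA j) jA;
    rewrite inE negbK => /eqP[/eqP ? /eqP ?].
rewrite inE; apply: contraR => jA.
have := implyP (E1 j) jA; have := implyP (E2 j) jA.
by rewrite /component => /eqP -> /eqP ->.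
Qed.

End Support.

(** * Counting correctly decoded errors *)

Section Symplectic.
Import boot.fintype boot.finset.
Variable n : nat.
Implicit Types (E x : pauli n) (A B : {set 'I_n}) (S : {vspace pauli n}).

(** The symplectic form, which makes anticommutation linear. *)
Definition omega E x : 'F_2 := \sum_j (E.1 0 j * x.2 0 j + E.2 0 j * x.1 0 j).

Lemma anticommuteE E x : (anticommute E x)%:R = omega E x.
Proof.
have odd_F2 k : (odd k)%:R = k%:R :> 'F_2.
  by elim: k => //= k IHk; rewrite -[k.+1]addn1 natrD -IHk; case: (odd k); apply: val_inj.
rewrite odd_F2 -sum1_card natr_sum big_mkcond /=; apply: eq_bigr => j _.
rewrite inE /component !xpair_eqE.
have F2 (a : 'F_2) : a = 0 \/ a = 1.
  by case: a => [[|[|//]] lt]; [left | right]; apply: val_inj.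
by case: (F2 (E.1 0 j)) => ->; case: (F2 (E.2 0 j)) => ->;
   case: (F2 (x.1 0 j)) => ->; case: (F2 (x.2 0 j)) => ->; apply: val_inj.
Qed.

Fact omega_is_linear E : linear (omega E : pauli n -> ('F_2)^o).
Proof.
move=> a [x z] [x' z']; rewrite /omega scaler_sumr -big_split /=.
by apply: eq_bigr => j _; rewrite !mxE /GRing.scale /=; ring.
Qed.

HB.instance Definition _ E :=
  GRing.isLinear.Build 'F_2 (pauli n) ('F_2)^o _ (omega E) (omega_is_linear E).

Lemma omegaBl E E' x : omega (E - E') x = omega E x - omega E' x.
Proof.
rewrite /omega -sumrB; apply: eq_bigr => j _.
by case: E E' => [? ?] [? ?]; rewrite !mxE; ring.
Qed.

Lemma omega_span (X : seq (pauli n)) E x :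
  (forall y, y \in X -> omega E y = 0) -> x \in <<X>>%VS -> omega E x = 0.
Proof.
move=> X0 xX; have : (<<X>> <= lker (linfun (omega E : pauli n -> ('F_2)^o)))%VS.
  by apply/span_subvP => y /X0 y0; rewrite memv_ker lfunE /= y0.
by move/subvP/(_ x xX); rewrite memv_ker lfunE => /eqP.
Qed.

Lemma omega_disjoint E x : [disjoint psupport E & psupport x] -> omega E x = 0.
Proof.
move=> dis; apply: big1 => j _; have [jE | jE] := boolP (j \in psupport E).
  by have := disjointFr dis jE; rewrite inE => /negbFE/eqP[-> ->]; rewrite !mulr0 addr0.
by move: jE; rewrite inE negbK => /eqP[-> ->]; rewrite !mul0r addr0.
Qed.

End Symplectic.

Section Decoding.
Import boot.fintype boot.finset.
Variable C : stabcode.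
Notation n := (len C).
Notation S := (stabgroup C).
Implicit Types (E : pauli n) (A : {set 'I_n}).

(** [W] complements in S the subgroup supported off A. An error inside A commutes with that
    subgroup, so its pairings [phi] with a basis of [W] determine its syndrome. Correctly decoded
    errors with equal [phi] thus get the same guess and lie in one coset of S: they differ by an
    element of S supported in A. This bounds each fibre of [phi] by 2^h(A), and there are 2^(dim W)
    fibres. *)
Lemma card_decoded A (T : 'rV['F_2]_(ngens C) -> {set pauli n}) :
  (#|[set E : pauli n | (psupport E \subset A) && (T (syndrome E) == pcoset S E)]|
     * 2 ^ subdim S (~: A) <= 2 ^ (\dim S + subdim S A))%N.
Proof.
set G := [set E | _]; pose W := (S :\: supp_space (~: A))%VS.
pose phi E : 'rV['F_2]_(\dim W) := \row_i omega E (vbasis W)`_i.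
have sub_phi E E0 : E \in G -> E0 \in G -> phi E = phi E0 ->
    E - E0 \in (S :&: supp_space A)%VS.
  rewrite !inE => /andP[sE /eqP TE] /andP[sE0 /eqP TE0] /rowP eq_phi.
  have sD : E - E0 \in supp_space A by rewrite rpredB ?mem_supp_space.
  have D0 x : x \in S -> omega (E - E0) x = 0.
    rewrite -{1}(addv_diff_cap S (supp_space (~: A))) => /memv_addP[w wW [u uS ->]].
    have -> : omega (E - E0) (w + u) = omega (E - E0) w + omega (E - E0) u.
      exact: (raddfD (omega (E - E0))).
    rewrite [X in X + _](_ : _ = 0) ?add0r; last first.
      have wB : w \in <<vbasis W>>%VS by rewrite (span_basis (vbasisP W)).
      apply: omega_span wB => y /(nthP 0)[i]; rewrite size_tuple => lti <-.
      by have := eq_phi (Ordinal lti); rewrite !mxE omegaBl => ->; rewrite subrr.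
    apply: omega_disjoint; move: uS sD; rewrite memv_cap !mem_supp_space.
    move=> /andP[_ su] sD; apply: disjointWl sD _.
    by rewrite disjoint_sym disjoints_subset.
  have eq_synd : syndrome E = syndrome E0.
    apply/rowP => i; rewrite !mxE !anticommuteE; apply/eqP; rewrite -subr_eq0.
    by rewrite -omegaBl D0 // memv_span // mem_tnth.
  rewrite memv_cap sD andbT.
  have : E \in pcoset S E0.
    rewrite -TE0 -eq_synd TE; apply/imsetP; exists 0; rewrite ?addr0 //.
    exact: mem0v.
  by case/imsetP => s sS ->; rewrite addrC addKr.
have card_fiber v : (#|[set E in G | phi E == v]| <= 2 ^ subdim S A)%N.
  have [-> | [E0]] := set_0Vmem [set E in G | phi E == v]; first by rewrite cards0.
  rewrite inE => /andP[GE0 /eqP phiE0].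
  have <- : #|(S :&: supp_space A)%VS| = (2 ^ subdim S A)%N.
    by rewrite card_vspace card_Fp //.
  rewrite -(card_imset _ (addIr (- E0))); apply: subset_leq_card.
  apply/subsetP => D /imsetP[E]; rewrite inE => /andP[GE /eqP phiE] ->.
  by apply: sub_phi; rewrite ?phiE.
have dimS := dimv_cap_compl S (supp_space (~: A)).
rewrite -dimS addnAC -addnA expnD mulnC leq_mul2l; apply/orP; right.
rewrite -sum1_card (partition_big phi xpredT) //=.
apply: leq_trans (_ : \sum_(v : 'rV['F_2]_(\dim W)) 2 ^ subdim S A <= _)%N.
  apply: leq_sum => v _; rewrite sum1_card; apply: leq_trans (card_fiber v).
  by apply: subset_leq_card; apply/subsetP => E GE; rewrite inE; apply: GE.
by rewrite sum_nat_const card_mx card_Fp // mul1n expnD mulnC.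
Qed.

End Decoding.

(** * The erasure channel *)

Section ErasureBound.
Import boot.fintype boot.finset.
Variables (F : realType) (p : F).
Hypothesis p01 : 0 <= p <= 1.
Variable C : stabcode.
Notation n := (len C).
Notation S := (stabgroup C).
Implicit Types (E : pauli n) (A : {set 'I_n}).

Definition indicator A : 'rV['F_2]_n := \row_i (i \in A)%:R.

Lemma indicator_bij : bijective indicator.
Proof.
exists (fun e : 'rV['F_2]_n => [set i | e 0 i == 1]) => [A | e].
  by apply/setP => i; rewrite inE mxE; case: (i \in A).
apply/rowP => i; rewrite mxE inE; case: (e 0 i) => [[|[|//]] lt]; exact: val_inj.
Qed.

Lemma erasure_prob_indicator A : erasure_prob p (indicator A) = subset_prob p A.
Proof. by apply: eq_bigr => i _; rewrite mxE; case: (i \in A). Qed.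

Lemma mem_supported_indicator A E :
  (E \in supported (indicator A)) = (psupport E \subset A).
Proof.
rewrite inE; apply/forallP/subsetP => [sE i | sE i].
  by rewrite inE; apply: contraR => iA; apply: (implyP (sE i)); rewrite mxE (negPf iA).
rewrite mxE; apply/implyP => iA; have := contra (sE i).
by rewrite inE negbK; apply; apply: contraTN iA => ->.
Qed.

Definition decoded (d : decoder C) A : {set pauli n} :=
  [set E | (psupport E \subset A) && (d (indicator A, syndrome E) == pcoset S E)].

Lemma decoded_le (d : decoder C) A : (#|decoded d A| <= 4 ^ #|A|)%N.
Proof.
rewrite -card_supp_space; apply: subset_leq_card; apply/subsetP => E.
by rewrite inE mem_supp_space => /andP[].
Qed.

Lemma conditional_error (d : decoder C) A :
  \sum_(E : pauli n) error_prob F (indicator A) E *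
     (d (indicator A, syndrome E) != pcoset S E)%:R =
  1 - #|decoded d A|%:R / (4 ^ #|A|)%:R.
Proof.
have cardV : #|supported (indicator A)| = (4 ^ #|A|)%N.
  rewrite -card_supp_space; apply: eq_card => E.
  by rewrite mem_supported_indicator mem_supp_space.
have N0 : (4 ^ #|A|)%:R != 0 :> F by rewrite pnatr_eq0 expn_eq0.
transitivity (\sum_(E in supported (indicator A)) (4 ^ #|A|)%:R^-1 -
   \sum_(E in decoded d A) (4 ^ #|A|)%:R^-1 : F).
  rewrite [X in X - _]big_mkcond [X in _ - X]big_mkcond -sumrB /=.
  apply: eq_bigr => E _; rewrite /error_prob cardV mem_supported_indicator inE.
  by case: (_ \subset _); case: eqP => _ /=; ring.
rewrite !sumr_const cardV -[X in X - _]mulr_natr mulVf //.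
by rewrite -[X in _ - X]mulr_natr mulrC.
Qed.

(* Either the decoder is right with probability at most 1/2, or the left-hand  *)
(* side is nonpositive.                                                        *)
Lemma conditional_error_ge (d : decoder C) A :
  (2 * #|A| + subdim S (~: A))%:R - (\dim S + subdim S A)%:R <=
  4 * n%:R * (1 - #|decoded d A|%:R / (4 ^ #|A|)%:R) :> F.
Proof.
have N0 : 0 < (4 ^ #|A|)%:R :> F by rewrite ltr0n expn_gt0.
have [le_ba | lt_ab] := leqP (2 * #|A| + subdim S (~: A)) (\dim S + subdim S A).
  apply: (@le_trans _ _ 0); first by rewrite subr_le0 ler_nat.
  rewrite mulr_ge0 ?mulr_ge0 ?ler0n // subr_ge0 ler_pdivrMr // mul1r ler_nat.
  exact: decoded_le.
have half : #|decoded d A|%:R / (4 ^ #|A|)%:R <= 1 / 2 :> F.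
  rewrite ler_pdivrMr //.
  have : (2 * #|decoded d A| <= 4 ^ #|A|)%N.
    have := card_decoded A (fun s => d (indicator A, s)); rewrite -/(decoded d A) => le1.
    (* The exponents are integers, so a strict inequality between them already yields a factor 2. *)
    have le2 : (2 ^ (\dim S + subdim S A).+1 <= 2 ^ (2 * #|A| + subdim S (~: A)))%N.
      by rewrite leq_exp2l.
    rewrite -(leq_pmul2r (expn_gt0 2 (subdim S (~: A)))) -mulnA.
    apply: leq_trans (leq_mul (leqnn 2) le1) _.
    by rewrite -expnS; apply: leq_trans le2 _; rewrite expnD expnM.
  by rewrite -(ler_nat F) natrM; lra.
(* The left-hand side is at most 2n; as the error is at least 1/2, the factor 4n suffices. *)
have ge_n : (2 * #|A| + subdim S (~: A) <= 2 * n + (\dim S + subdim S A))%N.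
  rewrite leq_add ?leq_mul2l //; first by rewrite -[leqRHS]card_ord max_card.
  exact: leq_trans (subdim_le _ _) (leq_addr _ _).
move: ge_n; rewrite -(ler_nat F) natrD natrM; move: half => + le2n.
set x := _ / _ => half.
have : 4 * n%:R * (1 / 2) <= 4 * n%:R * (1 - x) :> F.
  by rewrite ler_wpM2l ?mulr_ge0 ?ler0n //; lra.
lra.
Qed.

Lemma decoder_error_ge (d : decoder C) :
  2 * p * n%:R + expect (1 - p) (fun A => (subdim S A)%:R)
    - (\dim S)%:R - expect p (fun A => (subdim S A)%:R)
  <= 4 * n%:R * decoder_error p d.
Proof.
have -> : decoder_error p d =
    expect p (fun A => 1 - #|decoded d A|%:R / (4 ^ #|A|)%:R).
  rewrite /decoder_error (reindex indicator) /=; last exact/onW_bij/indicator_bij.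
  apply: eq_bigr => A _; rewrite -conditional_error mulr_sumr.
  by apply: eq_bigr => E _; rewrite erasure_prob_indicator mulrA.
rewrite -expectZ.
apply: le_trans (ler_expect p01 (fun A => conditional_error_ge d A)).
(* The complement of a random set of density p has density 1-p. *)
rewrite expectC -addrA -opprD.
rewrite [leRHS](_ : _ = expect p (fun A =>
    (2 * #|A|%:R + (subdim S (~: A))%:R) + -1 * ((\dim S)%:R + (subdim S A)%:R)));
  last by apply: eq_expect => A; rewrite natrD natrM natrD mulN1r.
by rewrite expectD expectZ !expectD expectZ expect_cst expect_card card_ord mulN1r mulrA.
Qed.

Lemma Perr_ge :
  2 * p * n%:R + expect (1 - p) (fun A => (subdim S A)%:R)
    - (\dim S)%:R - expect p (fun A => (subdim S A)%:R)
  <= 4 * n%:R * Perr p C.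
Proof.
have n0 : 0 < 4 * n%:R :> F by rewrite mulr_gt0 // ltr0n len_gt0.
rewrite -ler_pdivrMl //; apply/bigmin_geP; split=> [|d _]; last first.
  by rewrite ler_pdivrMl // decoder_error_ge.
(* What remains is the default value 1 of the minimum: since g(1-p) is at most r and g(p) is
   nonnegative, the left-hand side is at most 2pn, hence at most 4n. *)
have q01 : 0 <= 1 - p <= 1 by move: p01; lra.
have subdim_expect : expect (1 - p) (fun A => (subdim S A)%:R) <= (\dim S)%:R :> F.
  rewrite -[leRHS](expect_cst 'I_n (1 - p)); apply: ler_expect => // A.
  by rewrite ler_nat subdim_le.
have subdim_ge0 : 0 <= expect p (fun A => (subdim S A)%:R) :> F.
  by rewrite -(expect_cst 'I_n p 0); apply: ler_expect => // A; rewrite ler0n.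
have : p * n%:R <= n%:R by rewrite ler_piMl ?ler0n; case/andP: p01.
by rewrite ler_pdivrMl // mulr1; move: n0; lra.
Qed.

End ErasureBound.

(** * The rate bound and its limit *)

Lemma Perr_lower_bound (F : realType) (p : F) (m : nat) (C : stabcode) :
    0 < p -> p <= 1 / 2 -> (1 <= m)%N -> has_generators_of_weight m C ->
  2 * p - 4 * Perr p C <=
    (1 - rate F C) * (1 - (1 - 2 * p) * (1 - p) ^+ (m - 1)).
Proof.
move=> p0 p_le m1 [t spant wt]; have p01 : 0 <= p <= 1 by lra.
have q01 : 0 <= 1 - p <= 1 by lra.
have n0 : 0 < (len C)%:R :> F by rewrite ltr0n len_gt0.
have := Perr_ge p01 C.
have := expect_subdim_ge q01 spant wt.
set h := fun A => (subdim (stabgroup C) A)%:R : F.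
(* The thinning ratio from density 1-p to density p; it is at most 1 because p is at most 1/2. *)
have s01 : 0 <= p / (1 - p) <= 1.
  by rewrite divr_ge0 ?ler_pdivrMr /=; lra.
have h0 : h finset.set0 = 0 by rewrite /h subdim0.
have hS A B : h A + h B <= h (A :&: B)%SET + h (A :|: B)%SET.
  by rewrite -!natrD ler_nat subdim_supermodular.
have := supermodular_expect h0 hS s01 q01.
rewrite mulfVK; last by lra.
have -> : (1 - p) ^+ m = (1 - p) ^+ (m - 1) * (1 - p) by rewrite -exprSr subn1 prednK.
set a := (1 - p) ^+ _.
set g := expect (1 - p) h; set g' := expect p h; rewrite /rate.
set r := (\dim _)%:R; set n := (len C)%:R => conv low err.
rewrite -(ler_pM2l n0).
have -> : n * ((1 - (n - r) / n) * (1 - (1 - 2 * p) * a)) =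
    r * (1 - (1 - 2 * p) * a) by field; rewrite gt_eqF.
have q0 : 0 < 1 - p by lra.
(* Thinning gives g - g' at least (1-2p)g/(1-p); dividing by 1-p lowers the exponent m to m-1. *)
have low' : (1 - 2 * p) * (a * r) <= g - g'.
  apply: (@le_trans _ _ ((1 - 2 * p) * (g / (1 - p)))).
    rewrite ler_wpM2l //; first by lra.
    by rewrite ler_pdivlMr // mulrAC.
  have gE : g = (1 - p) * (g / (1 - p)) by field; rewrite gt_eqF.
  by move: conv; rewrite -mulrA [_ * g]mulrC {3}gE; set x := g / _; lra.
lra.
Qed.

Local Open Scope classical_set_scope.

Theorem theorem3p8 (F : realType) (p : F) (m : nat) (R : F)
    (C : nat -> stabcode)
    (p_gt0 : 0 < p) (p_le : p <= 1 / 2) (m_ge1 : (1 <= m)%N)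
    (R_ge0 : 0 <= R) (R_le1 : R <= 1)
    (rateC : forall t : nat, R <= rate F (C t))
    (PerrC : (fun t : nat => Perr p (C t)) @ \oo --> (0 : F))
    (ldpcC : forall t : nat, has_generators_of_weight m (C t)) :
  R <= (1 - 2 * p) * ((1 - (1 - p) ^+ (m - 1)) /
                      (1 - (1 - 2 * p) * (1 - p) ^+ (m - 1))).
Proof.
have a_ge0 : 0 <= (1 - p) ^+ (m - 1) by rewrite exprn_ge0; lra.
have a_le1 : (1 - p) ^+ (m - 1) <= 1 by rewrite exprn_ile1; lra.
set a := (1 - p) ^+ (m - 1) in a_ge0 a_le1 *.
(* As a is at most 1, the denominator is at least 2p. *)
have den : 0 < 1 - (1 - 2 * p) * a.
  have : (1 - 2 * p) * a <= (1 - 2 * p) * 1 by rewrite ler_wpM2l //; lra.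
  lra.
(* With R in place of the rate, the left-hand side no longer depends on t and survives the limit. *)
have main t : 2 * p - (1 - R) * (1 - (1 - 2 * p) * a) <= 4 * Perr p (C t).
  have := Perr_lower_bound p_gt0 p_le m_ge1 (ldpcC t); rewrite -/a.
  have : (1 - rate F (C t)) * (1 - (1 - 2 * p) * a) <= (1 - R) * (1 - (1 - 2 * p) * a).
    by apply: ler_wpM2r; [exact: ltW | have := rateC t; lra].
  lra.
have lim0 : (fun t => 4 * Perr p (C t)) @ \oo --> (0 : F).
  by rewrite -[X in _ --> X](mulr0 4); apply: cvgMr.
have le0 : 2 * p - (1 - R) * (1 - (1 - 2 * p) * a) <= 0.
  rewrite -(cvg_lim (@Rhausdorff F) lim0); apply: limr_ge; last exact: nearW.
  by apply/cvg_ex; exists 0.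
(* Rearranges [le0] using 1 - (1-2p)a - 2p = (1-2p)(1-a). *)
by rewrite mulrA ler_pdivlMr //; lra.
Qed.
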